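(* Let $\delta$ be a valley-free range map and $\mathcal{S}$ be a graded subset of $\mathsf{Cl}_\delta$. If $\mathcal{S}$ is closed by prefix and is closed by suffix reduction, then $\mathbf{Cl}_{\mathcal{S}}$ is a quotient algebra of the unital associative algebra $(\mathbf{Cl}_\delta,\cdot,\mathds{1})$.
   Context: $\mathbb{K}$ is a field of characteristic zero, $\mathbb{N}=\{0,1,2,\dots\}$. A range map is a map $\delta:\mathbb{N}\setminus\{0\}\to\mathbb{N}$; it is valley-free if there are no $1\leq i_1<i_2<i_3$ with $\delta(i_1)>\delta(i_2)<\delta(i_3)$. A $\delta$-cliff is a finite word $u=u_1\cdots u_n$ of nonnegative integers with $u_i\leq\delta(i)$ for all $i$; $\mathsf{Cl}_\delta$ is the set of all of them (graded by length), including the empty word $\epsilon$; a graded subset is a subset graded by length. $\mathbf{Cl}_\delta$ is the $\mathbb{K}$-vector space with basis $\{\mathsf{F}_u:u\in\mathsf{Cl}_\delta\}$. For a word $v\in\mathbb{N}^n$, $\mathrm{r}_\delta(v)$ is the $\delta$-cliff with $\mathrm{r}_\delta(v)_i:=\min\{v_i,\delta(i)\}$. The product is the bilinear map $\mathsf{F}_u\cdot\mathsf{F}_v=\sum_{v'}\mathsf{F}_{uv'}$, summed over all words $v'\in\mathbb{N}^{|v|}$ such that $\mathrm{r}_\delta(v')=v$ and $uv'\in\mathsf{Cl}_\delta$ ($uv'$ is the concatenation). The unit $\mathds{1}:\mathbb{K}\to\mathbf{Cl}_\delta$ sends $1$ to $\mathsf{F}_\epsilon$. For valley-free $\delta$ this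 is a unital associative algebra. $\mathbf{Cl}_{\mathcal{S}}:=\mathbf{Cl}_\delta/\mathcal{V}_{\mathcal{S}}$, where $\mathcal{V}_{\mathcal{S}}$ is the linear span of $\{\mathsf{F}_u:u\in\mathsf{Cl}_\delta\setminus\mathcal{S}\}$. Being a quotient algebra means that $\mathcal{V}_{\mathcal{S}}$ is a two-sided ideal, so that the product passes to the quotient. $\mathcal{S}$ is closed by prefix if every prefix of an element of $\mathcal{S}$ (including the empty one) is in $\mathcal{S}$; it is closed by suffix reduction if for every $u\in\mathcal{S}$ and every suffix $u'$ of $u$, $\mathrm{r}_\delta(u')\in\mathcal{S}$. *)

(* Defs.v *)
From HB Require Import structures.
From mathcomp Require Import all_boot all_order all_algebra finmap.
From mathcomp Require Import monalg.
From mathcomp Require Import boolp.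
From mathcomp Require Import zify.

Set Implicit Arguments.
Unset Strict Implicit.
Unset Printing Implicit Defensive.

Import GRing.Theory.
Local Open Scope ring_scope.
Local Open Scope quotient_scope.

Section LinearSpan.
Context (K : fieldType) (V : lmodType K).

Definition lspan (X : V -> Prop) : {pred V} :=
  fun x => `[< exists2 s : seq (K * V),
                 forall p, p \in s -> X p.2 & x = \sum_(p <- s) p.1 *: p.2 >].

Lemma lspan_submod_closed X : submod_closed (lspan X).
Proof.
split; first by apply/asboolP; exists [::]; rewrite ?big_nil.
move=> a x y /asboolP[s Xs ->] /asboolP[t Xt ->]; apply/asboolP.
exists ([seq (a * p.1, p.2) | p <- s] ++ t) => [p|].
  by rewrite mem_cat => /orP[/mapP[q qs ->]|/Xt//]; apply: (Xs q).
rewrite big_cat big_map scaler_sumr; congr (_ + _).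
by apply: eq_bigr => p _; rewrite scalerA.
Qed.

HB.instance Definition _ X :=
  GRing.isSubmodClosed.Build K V (lspan X) (lspan_submod_closed X).

End LinearSpan.

Section QuotientSpace.
Context (K : fieldType) (V : lmodType K) (I : submodClosed V).

(* MathComp's quotient is that of an additive group by a [zmodClosed] subset, *)
(* a structure that [submodClosed] does not inherit from.                     *)
Definition submod_pred : {pred V} := [pred x | x \in I].

Lemma submod_pred_zmod_closed : zmod_closed submod_pred.
Proof.
split=> [|x y]; rewrite !inE ?rpred0 // => Ix Iy.
by rewrite rpredD // -scaleN1r rpredZ.
Qed.

HB.instance Definition _ :=
  GRing.isZmodClosed.Build V submod_pred submod_pred_zmod_closed.

Definition lquot : Type := Quotient.quot submod_pred.

HB.instance Definition _ := GRing.Zmodule.on lquot.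
HB.instance Definition _ := EqQuotient.on lquot.

Definition lquot_scale (a : K) (x : lquot) : lquot :=
  \pi_lquot (a *: repr x).

Lemma lquot_piE (x y : V) : (\pi_lquot x == \pi_lquot y) = (x - y \in I).
Proof. by rewrite -Quotient.idealrBE. Qed.

Lemma lquot_piD (x y : V) : \pi_lquot (x + y) = \pi_lquot x + \pi_lquot y.
Proof. exact: (raddfD (\pi_(Quotient.quot submod_pred))). Qed.

Lemma lquot_piZ a (x : V) : \pi_lquot (a *: x) = lquot_scale a (\pi_lquot x).
Proof.
apply/eqP; rewrite lquot_piE -scalerBr rpredZ // -lquot_piE.
by rewrite reprK.
Qed.

Lemma lquot_scaleA a b x :
  lquot_scale a (lquot_scale b x) = lquot_scale (a * b) x.
Proof. by elim/quotW: x => x; rewrite -(lquot_piZ b) -2!lquot_piZ scalerA. Qed.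

Lemma lquot_scale1 : left_id 1 lquot_scale.
Proof. by elim/quotW => x; rewrite -lquot_piZ scale1r. Qed.

Lemma lquot_scaleDr : right_distributive lquot_scale +%R.
Proof.
move=> a; elim/quotW=> x; elim/quotW=> y.
by rewrite -(lquot_piZ a x) -(lquot_piZ a y) -2!lquot_piD -lquot_piZ scalerDr.
Qed.

Lemma lquot_scaleDl x : {morph lquot_scale^~ x : a b / a + b}.
Proof.
by elim/quotW: x => x a b; rewrite -(lquot_piZ a) -(lquot_piZ b) -lquot_piZ -lquot_piD scalerDl.
Qed.

HB.instance Definition _ := GRing.Zmodule_isLmodule.Build K lquot
  lquot_scaleA lquot_scale1 lquot_scaleDr lquot_scaleDl.

End QuotientSpace.

Definition two_sided_ideal (K : fieldType) (A : algType K) (I : {pred A}) :=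
  submod_closed I /\
  (forall a x : A, x \in I -> (a * x \in I) && (x * a \in I)).

Record unital_assoc_bilinear (K : fieldType) (V : lmodType K)
    (mul : V -> V -> V) (one : V) : Prop := UnitalAssocBilinear {
  uab_mulA : associative mul;
  uab_mul1l : left_id one mul;
  uab_mul1r : right_id one mul;
  uab_mulDl : left_distributive mul +%R;
  uab_mulDr : right_distributive mul +%R;
  uab_mulZl : forall (a : K) x y, mul (a *: x) y = a *: mul x y;
  uab_mulZr : forall (a : K) x y, mul x (a *: y) = a *: mul x y
}.

(* The quotient is the zero algebra when I is everything (for VS S below: when *)
(* S is empty), so its structure cannot be stated as an [algType].            *)
Record quotient_algebra (K : fieldType) (A : algType K) (I : submodClosed A) :
    Prop := QuotientAlgebra {
  quotient_algebra_ideal : two_sided_ideal I;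
  quotient_algebra_mul : exists mul : lquot I -> lquot I -> lquot I,
    {morph \pi_(lquot I) : x y / x * y >-> mul x y} /\
    unital_assoc_bilinear mul (\pi_(lquot I) 1)
}.

(* A range map is encoded as a function on all of nat whose value at 0 is     *)
(* irrelevant. Words are lists, whose letter u_i is [nth 0 u i.-1].           *)
Definition valley_free (delta : nat -> nat) : Prop :=
  forall i1 i2 i3 : nat, (1 <= i1)%N -> (i1 < i2)%N -> (i2 < i3)%N ->
    ~ ((delta i2 < delta i1)%N /\ (delta i2 < delta i3)%N).

Section Cliffs.
Variable delta : nat -> nat.

Definition is_cliff (u : seq nat) : bool :=
  all (fun i => nth 0%N u i <= delta i.+1)%N (iota 0 (size u)).

Record cliff := Cliff { word :> seq nat; _ : is_cliff word }.

HB.instance Definition _ := [isSub for word].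
HB.instance Definition _ := [Countable of cliff by <:].

Definition empty_cliff : cliff := @Cliff [::] isT.

Definition reduce_word (v : seq nat) : seq nat :=
  mkseq (fun i => minn (nth 0%N v i) (delta i.+1)) (size v).

Lemma is_cliffP u :
  reflect (forall i, (i < size u)%N -> (nth 0%N u i <= delta i.+1)%N)
    (is_cliff u).
Proof.
apply: (iffP allP) => H i; first by move=> lti; apply: H; rewrite mem_iota.
by rewrite mem_iota => /H.
Qed.

Lemma size_reduce_word v : size (reduce_word v) = size v.
Proof. exact: size_mkseq. Qed.

Lemma nth_reduce_word v i :
  nth 0%N (reduce_word v) i = minn (nth 0%N v i) (delta i.+1).
Proof.
have [lti|gei] := ltnP i (size v); first by rewrite nth_mkseq.
by rewrite !nth_default ?min0n ?size_reduce_word.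
Qed.

Lemma reduce_word_cliff v : is_cliff (reduce_word v).
Proof. by apply/is_cliffP => i _; rewrite nth_reduce_word geq_minr. Qed.

Definition reduce (v : seq nat) : cliff := Cliff (reduce_word_cliff v).

(* All words w with size w = size bs and w_i <= bs_i.                         *)
Fixpoint bounded_words (bs : seq nat) : seq (seq nat) :=
  if bs is b :: bs' then
    [seq a :: w | a <- iota 0 b.+1, w <- bounded_words bs']
  else [:: [::]].

(* The cliffs u v' with r(v') = v, without repetition. Since u is a cliff,    *)
(* u v' is a cliff iff v'_i <= delta (size u + i) for all i; see              *)
(* [cliff_prodP] and [cliff_prod_uniq].                                       *)
Definition cliff_prod (u v : cliff) : seq cliff :=
  pmap insub
    [seq word u ++ v' | v' <- bounded_words
        (mkseq (fun i => delta (size u + i.+1)) (size v)) & reduce v' == v].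

Lemma mem_bounded_words bs w : (w \in bounded_words bs) =
  (size w == size bs) && all (fun i => nth 0 w i <= nth 0 bs i)%N
                             (iota 0 (size bs)).
Proof.
elim: bs w => [|b bs IH] w; first by case: w.
rewrite [bounded_words _]/(allpairs _ _ _).
apply/allpairsP/andP => [[[a w'] [ab wb ->]]|[sw /allP wle]].
  move: wb; rewrite [_.2]/= IH => /andP[/eqP sw /allP wle].
  split; first by rewrite /= sw.
  apply/allP => -[_|i]; first by rewrite /= -[0%N :: _]/(iota 0 b.+1) mem_iota in ab.
  by rewrite mem_iota => lti; apply: wle; rewrite mem_iota.
case: w sw wle => [|a w] // sw wle; exists (a, w); split=> //=.
  by rewrite -[0%N :: _]/(iota 0 b.+1) mem_iota; apply: (wle 0%N).
rewrite IH -eqSS sw; apply/allP => i; rewrite mem_iota => lti.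
by apply: (wle i.+1); rewrite mem_iota.
Qed.

Lemma bounded_words_uniq bs : uniq (bounded_words bs).
Proof.
elim: bs => // b bs IH; apply: allpairs_uniq => //; first exact: iota_uniq.
by move=> [a w] [a' w'] _ _ /= [-> ->].
Qed.

Lemma cliff_prod_uniq u v : uniq (cliff_prod u v).
Proof.
apply: (pmap_uniq (@insubK _ _ _)); rewrite map_inj_uniq.
  exact/filter_uniq/bounded_words_uniq.
by move=> x y /eqP; rewrite eqseq_cat // eqxx => /eqP.
Qed.

Lemma cliff_prodP (u v w : cliff) :
  reflect (exists v' : seq nat,
             [/\ size v' = size v, reduce v' = v & word w = word u ++ v'])
          (w \in cliff_prod u v).
Proof.
rewrite mem_pmap_sub; apply: (iffP mapP) => /= [[v']|[v' [sv rv wE]]].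
  rewrite mem_filter mem_bounded_words size_mkseq => /and3P[/eqP rv /eqP sv _].
  by exists v'.
exists v' => //; rewrite mem_filter rv eqxx mem_bounded_words size_mkseq sv.
rewrite eqxx; apply/allP => i; rewrite mem_iota => /= lti.
have /is_cliffP/(_ (size u + i)%N) := valP w.
rewrite /= wE size_cat ltn_add2l sv => /(_ lti).
by rewrite nth_cat ltnNge leq_addr /= addKn nth_mkseq // addnS.
Qed.

Lemma mem_cliff_prod (u v w : cliff) : (w \in cliff_prod u v) =
  (take (size u) w == u :> seq nat) && (reduce (drop (size u) w) == v).
Proof.
apply/cliff_prodP/andP => [[v' [sv rv ->]]|[/eqP tE /eqP rE]].
  by rewrite take_size_cat // drop_size_cat // rv !eqxx.
exists (drop (size u) w); split => //; last by rewrite -[X in X ++ _]tE cat_take_drop.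
by rewrite -rE /= size_reduce_word.
Qed.

Lemma reduce_word_id (u : cliff) : reduce_word u = u.
Proof.
apply: (@eq_from_nth _ 0%N); rewrite size_reduce_word // => i lti.
by rewrite nth_reduce_word; apply/minn_idPl; move/is_cliffP: (valP u); apply.
Qed.

Lemma reduce_id (u : cliff) : reduce u = u.
Proof. by apply: val_inj; rewrite /= reduce_word_id. Qed.

Lemma cliff_prod0l (v : cliff) : cliff_prod empty_cliff v = [:: v].
Proof.
apply/perm_small_eq => //; apply: uniq_perm => // [|w].
  exact: cliff_prod_uniq.
by rewrite mem_cliff_prod inE /= take0 drop0 reduce_id.
Qed.

Lemma cliff_prod0r (u : cliff) : cliff_prod u empty_cliff = [:: u].
Proof.
apply/perm_small_eq => //; apply: uniq_perm => // [|w].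
  exact: cliff_prod_uniq.
rewrite mem_cliff_prod inE; apply/andP/eqP => [[/eqP t /eqP /(congr1 word)/=]|->].
  move/(congr1 size); rewrite size_reduce_word size_drop => /eqP.
  rewrite subn_eq0 => le; apply: val_inj => /=; rewrite -[RHS]t.
  by rewrite take_oversize.
rewrite take_size drop_size eqxx; split=> //; exact/eqP/val_inj.
Qed.

Lemma take_reduce_word n v : take n (reduce_word v) = reduce_word (take n v).
Proof.
apply: (@eq_from_nth _ 0%N) => [|i].
  by rewrite size_reduce_word !size_take_min size_reduce_word.
rewrite size_take_min leq_min => /andP[lti _].
by rewrite nth_reduce_word !nth_take // nth_reduce_word.
Qed.

Lemma take_cliff (u : cliff) n : is_cliff (take n u).
Proof.
apply/is_cliffP => i; rewrite size_take_min leq_min => /andP[lt1 lt2].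
by rewrite nth_take //; move/is_cliffP: (valP u); apply.
Qed.

Hypothesis delta_vf : valley_free delta.

Lemma reduce_word_drop (z : cliff) m n :
  reduce_word (drop n (reduce_word (drop m z))) = reduce_word (drop (n + m) z).
Proof.
apply: (@eq_from_nth _ 0%N) => [|i].
  by rewrite !(size_reduce_word, size_drop) subnDA subnAC.
rewrite !(size_reduce_word, size_drop) => lti.
rewrite !(nth_reduce_word, nth_drop) addnA (addnC m n).
have /is_cliffP/(_ (n + m + i)%N) := valP z; rewrite [size _]/= => zle.
have {}zle : (nth 0 z (n + m + i) <= delta (n + m + i).+1)%N by apply: zle; lia.
have [->|n0] := posnP n; first by rewrite !add0n -minnA minnn.
have [m0|m0] := posnP m; first by rewrite m0 addn0 in zle *; congr minn; apply/minn_idPl.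
have := @delta_vf i.+1 (n + i).+1 (n + m + i).+1 isT.
have lt1 : (i.+1 < (n + i).+1)%N by lia.
have lt2 : ((n + i).+1 < (n + m + i).+1)%N by lia.
move=> /(_ lt1 lt2); lia.
Qed.

Lemma cliff_prodA (u v w : cliff) :
  perm_eq [seq z | y <- cliff_prod v w, z <- cliff_prod u y]
          [seq z | x <- cliff_prod u v, z <- cliff_prod x w].
Proof.
apply: uniq_perm.
- apply: allpairs_uniq_dep; first exact: cliff_prod_uniq.
    by move=> y _; apply: cliff_prod_uniq.
  move=> [y z] [y' z'] /allpairsPdep[y1 [z1 [_ h1 [e1 e2]]]].
  case/allpairsPdep => [y2 [z2 [_ h2 [e3 e4]]]] /= zz.
  move: h1 h2; rewrite -e1 -e2 -e3 -e4 /= zz !mem_cliff_prod.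
  by move=> /andP[_ /eqP <-] /andP[_ /eqP <-].
- apply: allpairs_uniq_dep; first exact: cliff_prod_uniq.
    by move=> y _; apply: cliff_prod_uniq.
  move=> [x z] [x' z'] /allpairsPdep[x1 [z1 [g1 h1 [e1 e2]]]].
  case/allpairsPdep => [x2 [z2 [g2 h2 [e3 e4]]]] /= zz.
  move: g1 g2 h1 h2; rewrite -e1 -e2 -e3 -e4 /= zz.
  move=> /cliff_prodP[a [sa _ xE]] /cliff_prodP[b [sb _ x'E]].
  rewrite !mem_cliff_prod => /andP[/eqP h1 _] /andP[/eqP h2 _].
  have xx : x = x'.
    by apply: val_inj => /=; rewrite -h1 -h2 xE x'E !size_cat sa sb.
  by rewrite xx.
move=> z; apply/allpairsPdep/allpairsPdep.
- move=> [y [z0 [hy hz e]]]; rewrite -{z0}e in hz.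
  move: hy hz; rewrite !mem_cliff_prod => /andP[/eqP tv /eqP rw] /andP[/eqP tu /eqP yE].
  have wyE : word y = reduce_word (drop (size u) z) by rewrite -yE.
  have szv : size (take (size v) (drop (size u) z)) = size v.
    by rewrite -[RHS](congr1 size tv) wyE take_reduce_word size_reduce_word.
  have szx : size (take (size u + size v) z) = (size u + size v)%N.
    by rewrite takeD tu size_cat szv.
  exists (Cliff (take_cliff z (size u + size v))), z.
  split=> //; rewrite mem_cliff_prod /= ?szx ?eqxx /=.
    rewrite takeD tu take_size_cat // drop_size_cat // eqxx /=.
    by apply/eqP/val_inj; rewrite /= -take_reduce_word -wyE.
  apply/eqP/val_inj; rewrite /= -rw /= wyE.
  by rewrite reduce_word_drop addnC.
move=> [x [z0 [hx hz e]]]; rewrite -{z0}e in hz.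
case/cliff_prodP: hx => a [sa ra xE].
case/cliff_prodP: hz => b [sb rb zE].
have zE' : word z = word u ++ a ++ b by rewrite zE xE catA.
exists (reduce (drop (size u) z)), z; split=> //; rewrite mem_cliff_prod.
  apply/andP; split.
    by rewrite /= take_reduce_word zE' drop_size_cat // take_size_cat // -ra.
  apply/eqP/val_inj; rewrite /= reduce_word_drop -rb /= zE' -drop_drop.
  by rewrite drop_size_cat // drop_size_cat // sa.
by rewrite zE' take_size_cat // -zE' !eqxx.
Qed.

End Cliffs.

Section CliffAlgebra.
Variables (K : fieldType) (delta : nat -> nat).

Local Notation M := {malg K[cliff delta]}.

Definition cliff_mul_basis (u v : cliff delta) : M :=
  \sum_(w <- cliff_prod u v) << w >>.

Definition cliff_mul (x y : M) : M :=
  \sum_(u <- msupp x) \sum_(v <- msupp y)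
    (x@_u * y@_v) *: cliff_mul_basis u v.

Lemma cliff_mulEw (d1 d2 : {fset cliff delta}) (x y : M) :
  (msupp x `<=` d1)%fset -> (msupp y `<=` d2)%fset ->
  cliff_mul x y = \sum_(u <- d1) \sum_(v <- d2)
    (x@_u * y@_v) *: cliff_mul_basis u v.
Proof.
move=> le1 le2; rewrite /cliff_mul (big_fset_incl _ le1) /=.
  apply: eq_bigr => u _; apply/big_fset_incl => // v _ /mcoeff_outdom ->.
  by rewrite mulr0 scale0r.
move=> u _ /mcoeff_outdom xu.
by rewrite big1 // => v _; rewrite xu mul0r scale0r.
Qed.

Lemma cliff_mulDl : left_distributive cliff_mul +%R.
Proof.
move=> x y z; have le := fsubset_refl (msupp z).
rewrite (cliff_mulEw (msuppD_le x y) le).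
rewrite (cliff_mulEw (fsubsetUl _ (msupp y)) le).
rewrite (cliff_mulEw (fsubsetUr (msupp x) _) le).
rewrite -big_split /=; apply: eq_bigr => u _.
rewrite -big_split /=; apply: eq_bigr => v _.
by rewrite mcoeffD mulrDl scalerDl.
Qed.

Lemma cliff_mulDr : right_distributive cliff_mul +%R.
Proof.
move=> z x y; have le := fsubset_refl (msupp z).
rewrite (cliff_mulEw le (msuppD_le x y)).
rewrite (cliff_mulEw le (fsubsetUl _ (msupp y))).
rewrite (cliff_mulEw le (fsubsetUr (msupp x) _)).
rewrite -big_split /=; apply: eq_bigr => u _.
rewrite -big_split /=; apply: eq_bigr => v _.
by rewrite mcoeffD mulrDr scalerDl.
Qed.

Lemma cliff_mulZl a (x y : M) : a *: cliff_mul x y = cliff_mul (a *: x) y.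
Proof.
rewrite (cliff_mulEw (msuppZ_le a x) (fsubset_refl _)) scaler_sumr.
apply: eq_bigr => u _; rewrite scaler_sumr; apply: eq_bigr => v _.
by rewrite scalerA mcoeffZ mulrA.
Qed.

Lemma cliff_mulZr a (x y : M) : a *: cliff_mul x y = cliff_mul x (a *: y).
Proof.
rewrite (cliff_mulEw (fsubset_refl _) (msuppZ_le a y)) scaler_sumr.
apply: eq_bigr => u _; rewrite scaler_sumr; apply: eq_bigr => v _.
by rewrite scalerA mcoeffZ mulrCA.
Qed.

Lemma cliff_mulUU (u v : cliff delta) :
  cliff_mul << u >> << v >> = cliff_mul_basis u v.
Proof.
rewrite (cliff_mulEw msuppU_le msuppU_le) !big_seq_fset1 !mcoeffUU.
by rewrite mulr1 scale1r.
Qed.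

Lemma malg_basisE (x : M) : x = \sum_(u <- msupp x) x@_u *: << u >>.
Proof.
rewrite {1}[x]monalgE; apply: eq_bigr => u _; apply/malgP => v.
by rewrite mcoeffZ !mcoeffU mulr_natr.
Qed.

Lemma malg_ind (P : M -> Prop) : P 0 -> (forall x y, P x -> P y -> P (x + y)) ->
  (forall a u, P (a *: << u >>)) -> forall x, P x.
Proof. by move=> P0 PD PU x; rewrite [x]malg_basisE; apply: big_ind. Qed.

Lemma cliff_mul0l y : cliff_mul 0 y = 0.
Proof. by have := cliff_mulZl 0 0 y; rewrite !scale0r => <-. Qed.

Lemma cliff_mul0r x : cliff_mul x 0 = 0.
Proof. by have := cliff_mulZr 0 x 0; rewrite !scale0r => <-. Qed.

Lemma cliff_mul_suml (I : Type) (s : seq I) (f : I -> M) y :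
  cliff_mul (\sum_(i <- s) f i) y = \sum_(i <- s) cliff_mul (f i) y.
Proof.
exact: (big_morph (cliff_mul^~ y) (fun a b => cliff_mulDl a b y) (cliff_mul0l y)).
Qed.

Lemma cliff_mul_sumr (I : Type) (s : seq I) (f : I -> M) x :
  cliff_mul x (\sum_(i <- s) f i) = \sum_(i <- s) cliff_mul x (f i).
Proof. exact: (big_morph (cliff_mul x) (cliff_mulDr x) (cliff_mul0r x)). Qed.

Lemma cliff_mul1l : left_id << empty_cliff delta >> cliff_mul.
Proof.
elim/malg_ind => [|x y xE yE|a u]; first exact: cliff_mul0r.
  by rewrite cliff_mulDr xE yE.
by rewrite -cliff_mulZr cliff_mulUU /cliff_mul_basis cliff_prod0l big_seq1.
Qed.

Lemma cliff_mul1r : right_id << empty_cliff delta >> cliff_mul.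
Proof.
elim/malg_ind => [|x y xE yE|a u]; first exact: cliff_mul0l.
  by rewrite cliff_mulDl xE yE.
by rewrite -cliff_mulZl cliff_mulUU /cliff_mul_basis cliff_prod0r big_seq1.
Qed.

Lemma cliff_one_neq0 : << empty_cliff delta >> != 0 :> M.
Proof. by rewrite monalgU_eq0 oner_eq0. Qed.

Lemma cliff_mulA : valley_free delta -> associative cliff_mul.
Proof.
move=> vf x y z; elim/malg_ind: x => [|x x' xE x'E|a u].
- by rewrite !cliff_mul0l.
- by rewrite !cliff_mulDl xE x'E.
rewrite -!cliff_mulZl; congr (_ *: _).
elim/malg_ind: y => [|y y' yE y'E|b v].
- by rewrite !(cliff_mul0l, cliff_mul0r).
- by rewrite !(cliff_mulDl, cliff_mulDr) yE y'E.
rewrite -!(cliff_mulZl, cliff_mulZr); congr (_ *: _).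
elim/malg_ind: z => [|z z' zE z'E|c w].
- by rewrite !cliff_mul0r.
- by rewrite !cliff_mulDr zE z'E.
rewrite -!cliff_mulZr; congr (_ *: _).
rewrite !cliff_mulUU /cliff_mul_basis cliff_mul_suml cliff_mul_sumr.
under eq_bigr do rewrite cliff_mulUU /cliff_mul_basis.
under [RHS]eq_bigr do rewrite cliff_mulUU /cliff_mul_basis.
have E r f : \sum_(x <- r) \sum_(w0 <- f x) << w0 >> =
    \sum_(z <- [seq z | x <- r, z <- f x]) << z >> :> M.
  by rewrite big_allpairs_dep.
by rewrite !E; apply/perm_big/(cliff_prodA vf).
Qed.

(* The product is associative only for valley-free maps, so the algebra type  *)
(* carries the proof of valley-freeness.                                      *)
Definition Cl (delta_vf : valley_free delta) : Type := M.

Variable delta_vf : valley_free delta.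

HB.instance Definition _ := GRing.Lmodule.on (Cl delta_vf).
HB.instance Definition _ := GRing.Zmodule_isNzRing.Build (Cl delta_vf)
  (cliff_mulA delta_vf) cliff_mul1l cliff_mul1r cliff_mulDl cliff_mulDr
  cliff_one_neq0.
HB.instance Definition _ :=
  GRing.Lmodule_isLalgebra.Build K (Cl delta_vf) cliff_mulZl.
HB.instance Definition _ :=
  GRing.Lalgebra_isAlgebra.Build K (Cl delta_vf) cliff_mulZr.

Definition F (u : cliff delta) : Cl delta_vf := << u >>.

Definition VS (S : cliff delta -> Prop) : {pred Cl delta_vf} :=
  lspan (fun x => exists2 u, ~ S u & x = F u).

HB.instance Definition _ S := GRing.SubmodClosed.on (VS S).

Lemma F_mul u v : F u * F v = \sum_(w <- cliff_prod u v) F w.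
Proof. exact: cliff_mulUU. Qed.

Lemma F_one : 1 = F (empty_cliff delta).
Proof. by []. Qed.

End CliffAlgebra.

Arguments F K {delta} delta_vf u.
Arguments VS K {delta} delta_vf S.

(* Prefixes of cliffs are cliffs, so it is enough to let u range over cliffs. *)
Definition closed_by_prefix (delta : nat -> nat) (S : cliff delta -> Prop) :=
  forall u v : cliff delta, prefix u v -> S v -> S u.

Definition closed_by_suffix_reduction (delta : nat -> nat)
    (S : cliff delta -> Prop) :=
  forall (u : cliff delta) (u' : seq nat), suffix u' u -> S u ->
    S (reduce delta u').

(* Main.v *)
Require Import Defs.
From HB Require Import structures.
From mathcomp Require Import all_boot all_order all_algebra.
From mathcomp Require Import boolp.

Import GRing.Theory.
Local Open Scope ring_scope.

(** Multiplying two basis elements [F u] and [F v] produces only words [w] that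
    have [u] as a prefix and [v] as the reduction of the complementary suffix.
    Both closure properties of [S] can be read contrapositively: if [w] were in
    [S], then so would be its prefix [u] and its reduced suffix [v]. Hence as
    soon as one of [u], [v] lies outside [S], every term of the product does
    ([cliff_prod_notin]), and by bilinearity ([lspan_mul]) the span of the [F u]
    with [u] outside [S] absorbs products on both sides. The quotient by such a
    subspace inherits the product, and with it all the algebra laws
    ([ideal_quotient_algebra]). *)

Lemma lspan_gen (K : fieldType) (V : lmodType K) (X : V -> Prop) (x : V) :
  X x -> x \in lspan X.
Proof.
move=> Xx; apply/asboolP; exists [:: (1, x)]; last by rewrite big_seq1 scale1r.
by move=> p; rewrite inE => /eqP->.
Qed.

(** Having two generating families lets the same lemma give stability on either
    side: one factor ranges over the whole algebra, the other over the ideal. *)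
Lemma lspan_mul (K : fieldType) (A : algType K) (X Y : A -> Prop)
    (I : submodClosed A) :
  (forall x y : A, X x -> Y y -> x * y \in I) ->
  forall x y : A, x \in lspan X -> y \in lspan Y -> x * y \in I.
Proof.
move=> XY x y /asboolP[s Xs ->] /asboolP[t Yt ->].
rewrite mulr_suml big_seq; apply: rpred_sum => p /Xs Xp.
rewrite mulr_sumr big_seq; apply: rpred_sum => q /Yt Yq.
by rewrite -scalerAl -scalerAr !rpredZ ?XY.
Qed.

(** By the identity [x y - x' y' = (x - x') y + x' (y - y')], the class of
    a product depends only on the classes of its factors; the laws then hold in
    the quotient because they hold for representatives. *)
Lemma ideal_quotient_algebra (K : fieldType) (A : algType K)
    (I : submodClosed A) :
  (forall a x : A, x \in I -> a * x \in I) ->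
  (forall a x : A, x \in I -> x * a \in I) -> quotient_algebra I.
Proof.
move=> Il Ir; split.
  split=> [|a x Ix]; last by rewrite Il ?Ir.
  by split=> [|a x y Ix Iy]; rewrite ?rpred0 ?rpredD ?rpredZ.
pose pi : A -> lquot I := \pi_(lquot I)%qT.
pose mul (x y : lquot I) : lquot I := pi (repr x * repr y).
have reprP z : z - repr (pi z) \in I by rewrite -lquot_piE reprK.
have piM x y : pi (x * y) = mul (pi x) (pi y).
  apply/eqP; rewrite lquot_piE.
  rewrite -[x * y](subrK (repr (pi x) * y)) -mulrBl -addrA -mulrBr.
  exact: rpredD (Ir _ _ (reprP x)) (Il _ _ (reprP y)).
exists mul; split; first exact: piM.
have piD x y : pi (x + y) = pi x + pi y by exact: lquot_piD.
have piZ a x : pi (a *: x) = a *: pi x by exact: lquot_piZ.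
have piK x : pi (repr x) = x by exact: reprK.
split.
- by move=> x y z; rewrite -[x]piK -[y]piK -[z]piK -!piM mulrA.
- by move=> x; rewrite -[x]piK -piM mul1r.
- by move=> x; rewrite -[x]piK -piM mulr1.
- by move=> x y z; rewrite -[x]piK -[y]piK -[z]piK -piD -!piM mulrDl piD.
- by move=> x y z; rewrite -[x]piK -[y]piK -[z]piK -piD -!piM mulrDr piD.
- by move=> a x y; rewrite -[x]piK -[y]piK -piZ -!piM -scalerAl piZ.
- by move=> a x y; rewrite -[x]piK -[y]piK -piZ -!piM -scalerAr piZ.
Qed.

Section CliffIdeal.
Variables (K : fieldType) (delta : nat -> nat) (delta_vf : valley_free delta).
Variable S : cliff delta -> Prop.
Hypotheses (S_prefix : closed_by_prefix S).
Hypotheses (S_suffix : closed_by_suffix_reduction S).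

Lemma cliff_prod_notin (u v w : cliff delta) :
  w \in cliff_prod u v -> ~ S u \/ ~ S v -> ~ S w.
Proof.
rewrite mem_cliff_prod => /andP[/eqP wu /eqP wv] nS Sw.
case: nS; apply.
  by apply: S_prefix Sw; rewrite -wu prefix_take.
by rewrite -wv; apply: S_suffix Sw; exact: suffix_drop.
Qed.

Lemma VS_F_mul (u v : cliff delta) :
  ~ S u \/ ~ S v -> F K delta_vf u * F K delta_vf v \in VS K delta_vf S.
Proof.
move=> nS; rewrite F_mul big_seq; apply: rpred_sum => w wuv.
by apply: lspan_gen; exists w => //; apply: cliff_prod_notin wuv nS.
Qed.

Lemma lspan_F (a : Cl K delta_vf) :
  a \in lspan (fun x => exists u, x = F K delta_vf u).
Proof.
rewrite [a]malg_basisE; apply: rpred_sum => u _; apply: rpredZ.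
by apply: lspan_gen; exists u.
Qed.

Lemma VS_mull (a x : Cl K delta_vf) :
  x \in VS K delta_vf S -> a * x \in VS K delta_vf S.
Proof.
apply: lspan_mul (lspan_F a) => _ _ [u ->] [v nSv ->].
by apply: VS_F_mul; right.
Qed.

Lemma VS_mulr (a x : Cl K delta_vf) :
  x \in VS K delta_vf S -> x * a \in VS K delta_vf S.
Proof.
move=> Sx; apply: lspan_mul Sx (lspan_F a) => _ _ [u nSu ->] [v ->].
by apply: VS_F_mul; left.
Qed.

End CliffIdeal.

Theorem proposition3p3p1 (K : fieldType) (charK : [pchar K] =i pred0)
    (delta : nat -> nat) (delta_vf : valley_free delta)
    (S : cliff delta -> Prop) :
  closed_by_prefix S -> closed_by_suffix_reduction S ->
  quotient_algebra (VS K delta_vf S).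
Proof.
move=> S_prefix S_suffix.
by apply: ideal_quotient_algebra => a x; [apply: VS_mull | apply: VS_mulr].
Qed.
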